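(* Let $\epsilon>0$. For all positive integers $n,k,m$ there exists a positive integer $N$ such that the following holds. If there exists an algorithm $A$ that, for every pair of distributions $p$ and $q$ supported on $[N]=\{1,\dots,N\}$, distinguishes the case $p=q$ from the case $\|p-q\|_{\mathcal{A}_k}\ge\epsilon$ while drawing $m$ samples, then there exists an algorithm $A'$ that, for every pair of distributions $p'$ and $q'$ supported on $[n]$, distinguishes the case $p'=q'$ from the case $\|p'-q'\|_{\mathcal{A}_k}\ge\epsilon$ using the same number $m$ of samples. Moreover, $A'$ only considers the ordering of the samples and ignores all other information.
   Context: For discrete distributions $p,q$ on $[N]$ and a positive integer $k$, $\|p-q\|_{\mathcal{A}_k}=\max\sum_{i=1}^k|p(I_i)-q(I_i)|$ over all partitions of $[N]$ into $k$ disjoint intervals of consecutive integers, where $p(J)=\sum_{i\in J}p_i$. ``Distinguishes'' means that the algorithm outputs the correct answer (``$=$'' versus ``far'') with probability at least $2/3$. An algorithm ``only considers the ordering of the samples'' if its output depends only on the relative order of the drawn sample values together with the record of which samples came from $p'$ and which from $q'$ (and its internal randomness), and not on the sample values themselves. *)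

(* Defs.v *)
From HB Require Import structures.
From mathcomp Require Import all_boot all_order all_algebra.
From mathcomp Require Import reals.

Set Implicit Arguments.
Unset Strict Implicit.
Unset Printing Implicit Defensive.

Import Order.TTheory GRing.Theory Num.Theory.
Local Open Scope ring_scope.

Record fdist (R : realType) (T : finType) := FDist {
  pmf :> {ffun T -> R};
  pmfP : [forall x, 0 <= pmf x] && (\sum_x pmf x == 1) }.

HB.instance Definition _ (R : realType) (T : finType) :=
  [isSub for @pmf R T].

Definition mass (R : realType) (T : finType) (p : fdist R T) (J : {set T}) : R :=
  \sum_(x in J) p x.

(* [N] = {1, ..., N} is represented by 'I_N = {0, ..., N - 1}. *)

Definition interval (N : nat) (J : {set 'I_N}) : bool :=
  [forall a in J, forall c in J, forall b : 'I_N,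
     (a <= b <= c)%N ==> (b \in J)].

(* Empty intervals are allowed, so that a partition into k intervals exists
   also when k > N. For k <= N this does not affect the maximum in ak_dist,
   since subdividing an interval never decreases the sum. *)
Definition interval_partition (N k : nat) (I : {ffun 'I_k -> {set 'I_N}}) : bool :=
  [&& [forall j, interval (I j)],
      [forall i, forall j, (i != j) ==> [disjoint I i & I j]]
    & \bigcup_j I j == [set: 'I_N]].

(* The default value 0 is harmless: the sums are nonnegative, and there is at
   least one interval partition as soon as k > 0. *)
Definition ak_dist (R : realType) (N k : nat) (p q : fdist R 'I_N) : R :=
  \big[Num.max/0]_(I : {ffun 'I_k -> {set 'I_N}} | interval_partition I)
     \sum_(j < k) `|mass p (I j) - mass q (I j)|.

Definition from_p : bool := true.
Definition from_q : bool := false.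
Definition says_equal : bool := true.
Definition says_far : bool := false.

(* The samples drawn so far, in chronological order, each with its source. *)
Definition history (N : nat) := seq (bool * 'I_N).

(* A randomized, possibly adaptive, algorithm: given the history, [query] is
   the law of the source of the next sample, and [answer] is the law of the
   final answer. Since the history records the sources as well as the values,
   using fresh randomness at each step is no loss of generality. *)
Record algorithm (R : realType) (N : nat) := Algorithm {
  query : history N -> fdist R bool;
  answer : history N -> fdist R bool }.

(* The probability that A outputs [b] after drawing m further independent
   samples, starting from the history h. *)
Fixpoint output_prob (R : realType) (N : nat) (A : algorithm R N)
    (p q : fdist R 'I_N) (m : nat) (h : history N) (b : bool) : R :=
  if m is m'.+1 then
    query A h from_p *
      (\sum_(x : 'I_N) p x * output_prob A p q m' (rcons h (from_p, x)) b) +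
    query A h from_q *
      (\sum_(x : 'I_N) q x * output_prob A p q m' (rcons h (from_q, x)) b)
  else answer A h b.

Definition distinguishes (R : realType) (N k m : nat) (eps : R)
    (A : algorithm R N) : Prop :=
  forall p q : fdist R 'I_N,
    (p = q -> 2 / 3 <= output_prob A p q m [::] says_equal) /\
    (eps <= ak_dist k p q -> 2 / 3 <= output_prob A p q m [::] says_far).

Definition sources (N : nat) (h : history N) : seq bool := [seq s.1 | s <- h].

Definition values (N : nat) (h : history N) : seq nat :=
  [seq nat_of_ord s.2 | s <- h].

(* Ties count as part of the relative order. *)
Definition same_order (N : nat) (h h' : history N) : Prop :=
  sources h = sources h' /\
  forall i j : nat, (i < size h)%N -> (j < size h)%N ->
    (nth 0%N (values h) i <= nth 0%N (values h) j)%N =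
    (nth 0%N (values h') i <= nth 0%N (values h') j)%N.

Definition order_only (R : realType) (N : nat) (A : algorithm R N) : Prop :=
  forall h h' : history N, same_order h h' ->
    query A h = query A h' /\ answer A h = answer A h'.

(* Main.v *)
(** Ramsey's theorem and a limiting argument are replaced by one ultralimit. If
    some [N] admits no algorithm, that [N] works vacuously. Otherwise fix an
    algorithm [A_N] for every [N] and a nonprincipal ultrafilter [U] on the
    naturals. For [s_0 < ... < s_(n-1) < s_n], relabelling [i] as [s_i] turns
    [A_(s_n)] into an algorithm on ['I_n] that still distinguishes, since the
    relabelling does not decrease the distance. Let [A'] be the limit of these
    algorithms, [s] running along the tensor power [U^(n+1)]. Output
    probabilities are polynomials in the query and answer laws, hence converge,
    and the bound [2/3] survives exactly. Coordinates of [U^(n+1)] are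
    indiscernibles: a limit involving only some of them depends only on their
    relative order, so [A'] only considers the ordering. *)

Require Import Defs.
From mathcomp Require Import all_boot all_order all_algebra.
From mathcomp Require Import reals.
From mathcomp Require Import boolp classical_sets filter topology normedtype.
From mathcomp Require Import zify.
Import Order.TTheory GRing.Theory Num.Theory.
Import numFieldNormedType.Exports.
Local Open Scope ring_scope.
Local Open Scope classical_set_scope.

(** * Ultrafilters and ultralimits in the unit interval *)

Lemma ultra_dichotomy (T : Type) (F : set_system T) : ProperFilter F ->
  (forall A, F A \/ F (~` A)) -> UltraFilter F.
Proof.
move=> FP dich; split=> // G GP FG; apply/seteqP; split=> // A GA.
case: (dich A) => // /FG GCA.
have: G (A `&` ~` A) by apply: filterI.
by rewrite setICr => /(filter_not_empty).
Qed.

Lemma ultra_map {T S : Type} {F : set_system T} (f : T -> S) :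
  UltraFilter F -> UltraFilter (f @ F).
Proof.
move=> FU; apply: ultra_dichotomy => A; rewrite /nbhs /=.
exact: (in_ultra_setVsetC (f @^-1` A) FU).
Qed.

Lemma ultra_cvg_unit_interval {R : realType} {T : Type} {F : set_system T}
    (f : T -> R) : UltraFilter F -> (forall t, 0 <= f t <= 1) ->
  exists2 l : R, 0 <= l <= 1 & f @ F --> l.
Proof.
move=> FU f01; have := @segment_compact R 0 1; rewrite compact_ultra.
move=> /(_ (f @ F) (ultra_map f FU)) /=; case.
  by apply: (@filterE _ F) => t /=; rewrite in_itv /=.
by move=> l [/=]; rewrite in_itv /= => l01 fl; exists l.
Qed.

(** * Tensor powers of a filter *)

(** Iterated quantifier: for [F]-most first entries, for [F]-most second entries, and so on, [P]
    holds. The head is quantified outermost, so each entry is generic relative to all earlier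
    ones. *)
Fixpoint tensor_power {T : Type} (F : set_system T) (n : nat) :
    set_system (seq T) :=
  if n is n'.+1 then
    [set P | F [set x | tensor_power F n' [set s | P (x :: s)]]]
  else [set P | P [::]].

Lemma tensor_power_proper {T : Type} {F : set_system T} n :
  ProperFilter F -> ProperFilter (tensor_power F n).
Proof.
move=> FP; elim: n => [|n IH] /=.
  by split=> //; split=> // P Q PQ; apply: PQ.
have FF : Filter (tensor_power F n.+1).
  split=> /=.
  - by apply: (@filterE _ F) => x /=; apply: filterT.
  - by move=> P Q; apply: (@filterS2 _ F) => x /=; exact: filterI.
  - move=> P Q PQ; apply: (@filterS _ F) => x /=.
    by apply: filterS => s /=; exact: PQ.
by split=> // H; have [x] := @filter_ex _ F _ _ H; exact: filter_not_empty.
Qed.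

Lemma tensor_power_ultra {T : Type} {F : set_system T} n :
  UltraFilter F -> UltraFilter (tensor_power F n).
Proof.
move=> FU; elim: n => [|n IH].
  apply: ultra_dichotomy => [|A /=]; first exact: tensor_power_proper.
  by case: (pselect (A [::])); [left|right].
apply: ultra_dichotomy => [|A /=]; first exact: tensor_power_proper.
have [|HF] := in_ultra_setVsetC
  [set x | tensor_power F n [set s | A (x :: s)]] FU; first by left.
right; apply: filterS HF => x /= nA.
by have [] := in_ultra_setVsetC [set s | A (x :: s)] IH.
Qed.

Lemma tensor_power_size {T : Type} {F : set_system T} n : ProperFilter F ->
  tensor_power F n [set s | size s = n].
Proof.
move=> FP; elim: n => [//|n IH] /=; apply: filterE => x /=.
by have := tensor_power_proper n FP => ?; apply: filterS IH => s /= ->.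
Qed.

(** Each entry is quantified after its predecessor is fixed, and the numbers above a fixed one form
    a set in [\oo], hence in [F]. *)
Lemma tensor_power_path {F : set_system nat} n x : ProperFilter F ->
  \oo `<=` F -> tensor_power F n [set s | path ltn x s].
Proof.
move=> FP Foo; elim: n x => [//|n IH] x /=.
have : F [set y | x < y]%N by apply: Foo; exact: nbhs_infty_gt.
apply: filterS => y /= xy; have := tensor_power_proper n FP => ?.
by apply: filterS (IH y) => s /=; rewrite xy.
Qed.

Lemma tensor_power_sorted {F : set_system nat} n : ProperFilter F ->
  \oo `<=` F -> tensor_power F n [set s | sorted ltn s].
Proof.
move=> FP Foo; have := tensor_power_proper n FP => ?.
by apply: filterS (tensor_power_path n 0%N FP Foo) => s /=; exact: path_sorted.
Qed.

(** * Indiscernibility of the coordinates *)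

(** The quantifier over a masked-out coordinate is vacuous: as [F] is proper, a constant statement
    holds [F]-mostly exactly when it holds. *)
Lemma tensor_power_mask {T : Type} {F : set_system T} (b : bitseq)
    (P : set (seq T)) : ProperFilter F ->
  tensor_power F (size b) [set s | P (mask b s)] =
  tensor_power F (count id b) P.
Proof.
move=> FP; elim: b P => [|[] b IH] P //=.
  by congr F; apply/funext => x /=; rewrite (IH [set s | P (x :: s)]).
rewrite -IH; apply/propext; split=> [/filter_ex[]//|H]; exact: filterE.
Qed.

Lemma nth_mask {T : Type} (x0 : T) (b : bitseq) (s : seq T) i :
  size s = size b -> nth false b i ->
  nth x0 (mask b s) (count id (take i b)) = nth x0 s i.
Proof.
elim: b s i => [|c b IH] [|x s] [|i] //=; first by case: c.
by case=> sz bi; case: c => /=; rewrite add0n ?add1n /= IH.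
Qed.

(* The rank of [x] among the distinct entries of [w]. *)
Definition below (w : seq nat) (x : nat) : nat :=
  size (undup [seq y <- w | (y < x)%N]).

(** Together with [nth_mask], this shows that a kept coordinate lands at the position given by its
    rank. *)
Lemma count_mem_iota (w : seq nat) i :
  count (mem w) (iota 0 i) = below w i.
Proof.
rewrite -size_filter; apply/perm_size/uniq_perm.
- exact/filter_uniq/iota_uniq.
- exact: undup_uniq.
- by move=> x; rewrite mem_undup !mem_filter mem_iota /= add0n andbC.
Qed.

Lemma size_undup_map_in {S T : eqType} (f : S -> T) (w : seq S) :
  {in w &, injective f} -> size (undup (map f w)) = size (undup w).
Proof.
move=> finj; rewrite -[RHS](size_map f); apply/perm_size/uniq_perm.
- exact: undup_uniq.
- rewrite map_inj_in_uniq ?undup_uniq// => x y.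
  by rewrite !mem_undup; exact: finj.
- by move=> x; rewrite mem_undup; apply/mapP/mapP => -[y yw ->]; exists y;
    rewrite // mem_undup in yw *.
Qed.

Definition order_iso (w w' : seq nat) : Prop :=
  size w = size w' /\
  forall i j : nat, (i < size w)%N -> (j < size w)%N ->
    (nth 0%N w i <= nth 0%N w j)%N = (nth 0%N w' i <= nth 0%N w' j)%N.

Lemma order_iso_map (w w' : seq nat) : order_iso w w' ->
  exists2 f : nat -> nat, w' = map f w &
    {in w &, forall x y, (f x < f y)%N = (x < y)%N}.
Proof.
(* [f x] reads [w'] at the first occurrence of [x] in [w]. Any other occurrence would give the same
   value, because ties in [w] are ties in [w']. *)
move=> [sz ord]; pose f x := nth 0%N w' (index x w).
have idx x : x \in w -> (index x w < size w)%N by rewrite index_mem.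
have fmono : {in w &, forall x y, (f x <= f y)%N = (x <= y)%N}.
  by move=> x y xw yw; rewrite /f -ord ?idx// !nth_index.
exists f; last by move=> x y xw yw; rewrite !ltnNge fmono.
apply: (@eq_from_nth _ 0%N); rewrite ?size_map// -sz => i iw.
rewrite (nth_map 0%N)//; have xw := mem_nth 0%N iw.
apply/eqP; rewrite eqn_leq /f -!ord ?idx// nth_index// leqnn //=.
Qed.

Lemma order_iso_rank (w w' : seq nat) : order_iso w w' ->
  size (undup w) = size (undup w') /\ map (below w) w = map (below w') w'.
Proof.
move=> /order_iso_map[f -> fmono].
have finj : {in w &, injective f}.
  by move=> x y xw yw fxy; case: (ltngtP x y) => //; rewrite -fmono// fxy ltnn.
split; first by rewrite size_undup_map_in.
rewrite -map_comp; apply/eq_in_map => x xw /=.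
rewrite /below filter_map size_undup_map_in.
  by congr (size (undup _)); apply: eq_in_filter => y yw /=; rewrite fmono.
by move=> y z; rewrite !mem_filter => /andP[_ ?] /andP[_ ?]; exact: finj.
Qed.

(** Masking out the coordinates absent from [w] renumbers the others by rank. The right-hand side
    therefore sees [w] only through its ranks and its number of distinct entries, both invariant
    under [order_iso]. *)
Lemma tensor_power_ranks {T : Type} {F : set_system T} (x0 : T) n (w : seq nat)
    (P : set (seq T)) : ProperFilter F -> all (gtn n) w ->
  tensor_power F n [set s | P [seq nth x0 s i | i <- w]] =
  tensor_power F (size (undup w))
    [set s | P [seq nth x0 s i | i <- map (below w) w]].
Proof.
move=> FP /allP wn; pose b := [seq i \in w | i <- iota 0 n].
have szb : size b = n by rewrite size_map size_iota.
have cb : count id b = size (undup w).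
  rewrite count_map (eq_count (a2 := mem w))// count_mem_iota /below.
  by rewrite (@eq_in_filter _ _ predT) ?filter_predT// => x /wn.
rewrite -cb -tensor_power_mask szb; have FnP := tensor_power_proper n FP.
have eqw s : size s = n -> [seq nth x0 s i | i <- w] =
    [seq nth x0 (mask b s) i | i <- map (below w) w].
  move=> szs; rewrite -map_comp; apply/eq_in_map => i iw /=.
  have /= ltin := wn _ iw.
  rewrite -count_mem_iota -(nth_mask x0 b) ?szb//; last first.
    by rewrite (nth_map 0%N) ?size_iota// nth_iota.
  by rewrite -map_take take_iota (minn_idPl (ltnW ltin)) count_map.
apply/propext; split; apply: filterS2 (tensor_power_size n FP) => s /= /eqw.
  by move=> <-.
by move=> ->.
Qed.

Lemma tensor_power_indiscernible {T : Type} {F : set_system T} (x0 : T) n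
    (w w' : seq nat) (P : set (seq T)) : ProperFilter F ->
  all (gtn n) w -> all (gtn n) w' -> order_iso w w' ->
  tensor_power F n [set s | P [seq nth x0 s i | i <- w]] =
  tensor_power F n [set s | P [seq nth x0 s i | i <- w']].
Proof.
move=> FP wn w'n /order_iso_rank[sz rk].
by rewrite (tensor_power_ranks x0 n w)// (tensor_power_ranks x0 n w')// sz rk.
Qed.

(** * Limits of distributions and of algorithms *)

Lemma fdist_ge0 {R : realType} {T : finType} (p : fdist R T) x : 0 <= p x.
Proof. by case: p => p /= /andP[/forallP]. Qed.

Lemma fdist_sum1 {R : realType} {T : finType} (p : fdist R T) :
  \sum_x p x = 1.
Proof. by case: p => p /= /andP[_ /eqP]. Qed.

Lemma fdist_bool_false {R : realType} (d : fdist R bool) :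
  d false = 1 - d true.
Proof. by rewrite -(fdist_sum1 d) big_bool addrC addKr. Qed.

Lemma fdist_bool_le1 {R : realType} (d : fdist R bool) : 0 <= d true <= 1.
Proof. by rewrite fdist_ge0 -subr_ge0 -fdist_bool_false fdist_ge0. Qed.

Lemma bernoulli_subproof {R : realType} (x : R) : 0 <= x <= 1 ->
  let f := [ffun b : bool => if b then x else 1 - x] in
  [forall b, 0 <= f b] && (\sum_b f b == 1).
Proof.
move=> /andP[x0 x1] /=; apply/andP; split.
  by apply/forallP => -[]; rewrite ffunE ?subr_ge0.
by rewrite big_bool !ffunE /= addrC subrK.
Qed.

(** A law on [bool] is determined by its mass at [true], so a single limit in the unit interval
    suffices. *)
Lemma fdist_bool_ultra_cvg {R : realType} {T : Type} {F : set_system T}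
    (f : T -> fdist R bool) : UltraFilter F ->
  exists d : fdist R bool, forall b, f t b @[t --> F] --> d b.
Proof.
move=> FU; have [l l01 fl] := ultra_cvg_unit_interval (fun t => f t true) FU
  (fun t => fdist_bool_le1 (f t)).
exists (FDist (bernoulli_subproof l l01)) => -[]; rewrite ffunE//.
under eq_fun do rewrite fdist_bool_false.
by apply: cvgB => //; exact: cvg_cst.
Qed.

Definition algorithm_cvg {R : realType} {T : Type} (F : set_system T) {n : nat}
    (B : T -> algorithm R n) (A : algorithm R n) : Prop :=
  forall h b, query (B t) h b @[t --> F] --> query A h b /\
    answer (B t) h b @[t --> F] --> answer A h b.

Lemma algorithm_ultra_cvg {R : realType} {T : Type} {F : set_system T} {n : nat}
    (B : T -> algorithm R n) : UltraFilter F ->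
  exists A, algorithm_cvg F B A.
Proof.
move=> FU.
have [q qP] := choice
  (fun h => fdist_bool_ultra_cvg (fun t => query (B t) h) FU).
have [a aP] := choice
  (fun h => fdist_bool_ultra_cvg (fun t => answer (B t) h) FU).
by exists (Algorithm q a).
Qed.

Lemma output_prob_cvg {R : realType} {T : Type} {F : set_system T} {n : nat}
    (B : T -> algorithm R n) (A : algorithm R n) (p q : fdist R 'I_n) m h b :
  Filter F -> algorithm_cvg F B A ->
  output_prob (B t) p q m h b @[t --> F] --> output_prob A p q m h b.
Proof.
move=> FF BA; elim: m h => [|m IH] h /=; first by have [] := BA h b.
have sum_cvg (r : fdist R 'I_n) c :
    \sum_x r x * output_prob (B t) p q m (rcons h (c, x)) b @[t --> F] -->
    \sum_x r x * output_prob A p q m (rcons h (c, x)) b.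
  apply: cvg_big => [|x _]; first exact: add_continuous.
  by apply: cvgM; [exact: cvg_cst|exact: IH].
by apply: cvgD; apply: cvgM => //; have [] := BA h from_p;
  have [] := BA h from_q.
Qed.

Lemma distinguishes_cvg {R : realType} {T : Type} {F : set_system T} {n : nat}
    (B : T -> algorithm R n) (A : algorithm R n) (eps : R) k m :
  ProperFilter F -> algorithm_cvg F B A ->
  (\forall t \near F, distinguishes k m eps (B t)) -> distinguishes k m eps A.
Proof.
move=> FP BA Bd p q; split=> pq;
  apply: (cvgr_to_ge (output_prob_cvg B A p q m [::] _ _ BA));
  apply: filterS Bd => t /(_ p q)[Beq Bfar]; [exact: Beq|exact: Bfar].
Qed.

(** * Relabelling of the sample values *)

Definition pullback {R : realType} {n N : nat} (y : 'I_n -> 'I_N)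
    (A : algorithm R N) : algorithm R n :=
  Algorithm (fun h => query A [seq (s.1, y s.2) | s <- h])
    (fun h => answer A [seq (s.1, y s.2) | s <- h]).

Lemma pushforward_subproof {R : realType} {S T : finType} (y : S -> T)
    (p : fdist R S) :
  let f := [ffun x => \sum_(i | y i == x) p i] in
  [forall x, 0 <= f x] && (\sum_x f x == 1).
Proof.
apply/andP; split.
  by apply/forallP => x; rewrite ffunE sumr_ge0// => i _; exact: fdist_ge0.
rewrite -(fdist_sum1 p) (partition_big y predT)//=.
by apply/eqP/eq_bigr => x _; rewrite ffunE.
Qed.

Definition pushforward {R : realType} {S T : finType} (y : S -> T)
    (p : fdist R S) : fdist R T := FDist (pushforward_subproof y p).

Lemma sum_pushforward {R : realType} {S T : finType} (y : S -> T)
    (p : fdist R S) (P : pred T) (g : T -> R) :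
  \sum_(x | P x) pushforward y p x * g x = \sum_(i | P (y i)) p i * g (y i).
Proof.
rewrite [RHS](partition_big y P)//=; apply: eq_bigr => x Px.
rewrite ffunE mulr_suml; apply: eq_big => [i|i /eqP<-//].
by case: eqP => [->|]; rewrite ?Px ?andbF.
Qed.

(** The image under [y] of a sample from [p] has law [pushforward y p], so feeding relabelled
    samples to [A] amounts to running [A] on the pushforwards. *)
Lemma output_prob_pullback {R : realType} {n N : nat} (y : 'I_n -> 'I_N)
    (A : algorithm R N) p q m h b :
  output_prob (pullback y A) p q m h b =
  output_prob A (pushforward y p) (pushforward y q) m
    [seq (s.1, y s.2) | s <- h] b.
Proof.
elim: m h => [//|m IH] h /=; rewrite !sum_pushforward.
by congr (_ * _ + _ * _); apply: eq_bigr => i _; rewrite IH map_rcons.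
Qed.

Lemma mass_pushforward_preimset {R : realType} {S T : finType} (y : S -> T)
    (f : T -> S) (p : fdist R S) (J : {set S}) : cancel y f ->
  mass (pushforward y p) (f @^-1: J) = mass p J.
Proof.
move=> yK; rewrite /mass.
under eq_bigr do rewrite -[pushforward _ _ _]mulr1.
rewrite sum_pushforward; apply: eq_big => [i|i _]; last by rewrite mulr1.
by rewrite inE yK.
Qed.

Lemma interval_partition_preimset {n N k : nat} (f : 'I_N -> 'I_n)
    (I : {ffun 'I_k -> {set 'I_n}}) :
  {homo f : x y / (x <= y)%N} -> interval_partition I ->
  interval_partition [ffun j => f @^-1: I j].
Proof.
move=> fmono /and3P[/forallP Iint /forallP Idis /eqP Icov]; apply/and3P; split.
- apply/forallP => j; rewrite ffunE; apply/forall_inP => a; rewrite inE => aI.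
  apply/forall_inP => c; rewrite inE => cI; apply/forallP => b.
  apply/implyP => /andP[ab bc]; rewrite inE.
  move: (Iint j) => /forall_inP/(_ _ aI)/forall_inP/(_ _ cI)/forallP/(_ (f b)).
  by rewrite !fmono.
- apply/forallP => i; apply/forallP => j; apply/implyP => ij; rewrite !ffunE.
  move: (Idis i) => /forallP/(_ j); rewrite ij /= -!finset.setI_eq0 -preimsetI.
  by move=> /eqP->; rewrite preimset0.
- apply/eqP/setP => x; rewrite finset.in_setT; apply/bigcupP.
  have /bigcupP[j _ fxj] : f x \in (\bigcup_j I j)%SET.
    by rewrite Icov finset.in_setT.
  by exists j => //; rewrite ffunE inE.
Qed.

(** Preimages under the monotone retraction [f] turn an interval partition of the small set into one
    of the large set with the same masses, so every sum on the left also competes on the right. *)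
Lemma le_ak_dist_pushforward {R : realType} {n N k : nat} (y : 'I_n -> 'I_N)
    (f : 'I_N -> 'I_n) (p q : fdist R 'I_n) :
  cancel y f -> {homo f : x y / (x <= y)%N} ->
  ak_dist k p q <= ak_dist k (pushforward y p) (pushforward y q).
Proof.
move=> yK fmono; apply: bigmax_le => [|I PI]; first exact: bigmax_ge_id.
apply: le_trans (le_bigmax_cond _ _ (interval_partition_preimset f I fmono PI)).
by under [leRHS]eq_bigr do
  rewrite !ffunE !(mass_pushforward_preimset y f _ _ yK).
Qed.

Lemma strict_homo_retraction {n N : nat} (y : 'I_n.+1 -> 'I_N) :
  {homo y : i j / (i < j)%N} ->
  exists2 f : 'I_N -> 'I_n.+1, cancel y f & {homo f : x y / (x <= y)%N}.
Proof.
move=> ymono.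
have yle i j : (y i <= y j)%N = (i <= j)%N.
  by case: (ltngtP i j) => [/ymono/ltnW//|/ymono ji|/val_inj->//]; lia.
(* The indices [i] with [y i <= x] form an initial segment, so [(c x).-1] is the last of them; when
   there is none, the predecessor of 0 gives index 0. *)
pose c (x : 'I_N) := #|[pred i | y i <= x]%N|.
have cn x : (c x <= n.+1)%N by rewrite -[leqRHS]card_ord max_card.
have cE x : (inord (c x).-1 : 'I_n.+1) = (c x).-1 :> nat.
  by rewrite (@inordK n)//; have := cn x; lia.
exists (fun x => inord (c x).-1) => [i|a b ab]; last first.
  rewrite !cE; have : (c a <= c b)%N.
    apply/subset_leq_card/fintype.subsetP => i; rewrite !inE => /leq_trans.
    exact.
  lia.
apply/val_inj; rewrite /= cE /c -sum1_card.
rewrite (eq_bigl (fun j : 'I_n.+1 => j < i.+1)%N); last first.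
  by move=> j; rewrite inE yle ltnS.
by rewrite -(big_ord_widen _ (fun=> 1%N))// sum1_card card_ord.
Qed.

Lemma distinguishes_pullback {R : realType} {n N : nat} (y : 'I_n -> 'I_N)
    (A : algorithm R N) (eps : R) k m :
  (0 < n)%N -> {homo y : i j / (i < j)%N} ->
  distinguishes k m eps A -> distinguishes k m eps (pullback y A).
Proof.
case: n y => // n y _ /strict_homo_retraction[f yK fmono] Ad p q.
rewrite !output_prob_pullback.
have [Aeq Afar] := Ad (pushforward y p) (pushforward y q).
split=> [pq|pq]; first by apply: Aeq; rewrite pq.
exact/Afar/(le_trans pq)/(le_ak_dist_pushforward y f).
Qed.

(** * Order patterns and the limit algorithm *)

Lemma values_lt {n : nat} (h : history n) j :
  (j < size h)%N -> (nth 0%N (values h) j < n)%N.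
Proof.
move=> jh; have := @mem_nth _ 0%N (values h) j; rewrite size_map => /(_ jh).
by move=> /mapP[x _ ->].
Qed.

(** The prepended [n] stands for the coordinate [s_n] that selects the algorithm. It lies above all
    sample values, so the order pattern extends to it. *)
Lemma same_order_iso {n : nat} (h h' : history n) :
  same_order h h' -> order_iso (n :: values h) (n :: values h').
Proof.
move=> [src ord]; have sz : size h = size h'.
  by have := congr1 size src; rewrite !size_map.
split=> [|[|i] [|j]]; rewrite /= ?size_map ?sz ?leqnn// !ltnS => ih jh.
- by rewrite [LHS]leqNgt [RHS]leqNgt !values_lt ?sz.
- by rewrite !(ltnW (values_lt _ _ _)) ?sz.
- by rewrite ord ?sz.
Qed.

Theorem theorem4p1 (R : realType) (eps : R) (heps : 0 < eps)
    (n k m : nat) (hn : (0 < n)%N) (hk : (0 < k)%N) (hm : (0 < m)%N) :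
  exists N : nat, (0 < N)%N /\
    ((exists A : algorithm R N, distinguishes k m eps A) ->
     exists A' : algorithm R n, distinguishes k m eps A' /\ order_only A').
Proof.
have [Aex|/existsNP[N nA]] := pselect (forall N,
    exists A : algorithm R N.+1, distinguishes k m eps A); last first.
  by exists N.+1; split.
(* By [Aex] every positive size admits an algorithm, so any positive witness will do. *)
exists 1%N; split=> // _.
pose A N := projT1 (cid (Aex N)).
have Ad N : distinguishes k m eps (A N) by rewrite /A; case: cid.
have [U [UU Uoo]] := @ultraFilterLemma _ \oo _.
(* [A N] lives on ['I_N.+1]. For increasing [s] of length [n.+1] the labels are below [s_n], so
   [inord] is faithful; other lists are negligible for the tensor power. *)
pose B (s : seq nat) :=
  pullback (fun i : 'I_n => inord (nth 0%N s i)) (A (nth 0%N s n)).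
have UP : ProperFilter U by exact: ultra_proper.
have FU := tensor_power_ultra n.+1 UU.
have FP := tensor_power_proper n.+1 UP.
have [A' BA'] := algorithm_ultra_cvg B FU.
exists A'; split.
  apply: (distinguishes_cvg B A' eps k m _ BA').
  have := tensor_power_sorted n.+1 UP Uoo.
  apply: filterS2 (tensor_power_size n.+1 UP) => s /= szs ss.
  apply: distinguishes_pullback => // i j ij.
  have lt_nth a b : (a < b < n.+1)%N -> (nth 0%N s a < nth 0%N s b)%N.
    move=> /andP[ab bn]; apply: (sorted_ltn_nth ltn_trans) => //;
      by rewrite inE szs// (ltn_trans ab).
  have y_lt (l : 'I_n) : (nth 0%N s l < (nth 0%N s n).+1)%N.
    by rewrite ltnS ltnW// lt_nth// ltn_ord ltnSn.
  by rewrite !inordK ?y_lt// lt_nth// ij ltnW// ltnS ltn_ord.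
move=> h h' hh'; have [src _] := hh'.
have iso := same_order_iso h h' hh'.
have valsP (g : history n) : all (gtn n.+1) (n :: values g).
  rewrite /= ltnSn; apply/allP => _ /mapP[x _ ->] /=.
  by rewrite ltnW// ltnS ltn_ord.
pose relabel s (g : history n) : history (nth 0%N s n).+1 :=
  [seq (t.1, inord (nth 0%N s t.2)) | t : bool * 'I_n <- g].
have relabelE s g : relabel s g =
    zip (sources g) [seq inord v | v <- [seq nth 0%N s i | i <- values g]].
  by elim: g => //= t g ->.
have same_limit (X : forall N, history N.+1 -> R) (l l' : R) :
    X _ (relabel s h) @[s --> tensor_power U n.+1] --> l ->
    X _ (relabel s h') @[s --> tensor_power U n.+1] --> l' -> l = l'.
  (* [G] reads the size and the labels from one plain list, which removes the dependence of the
     history type on [s]. The sources are common to [h] and [h'], so only the coordinates listed in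
     [n :: values h] and [n :: values h'] differ. *)
  pose G w := X (head 0%N w)
    (zip (sources h) [seq inord v | v <- behead w]).
  under eq_fun do rewrite relabelE.
  under [X in X @ _ --> l']eq_fun do rewrite relabelE -src.
  (* By indiscernibility the two image filters are equal, so their limits in [R] coincide. *)
  have GE : G [seq nth 0%N s i | i <- n :: values h]
        @[s --> tensor_power U n.+1] =
      G [seq nth 0%N s i | i <- n :: values h'] @[s --> tensor_power U n.+1].
    apply/funext => P.
    exact: (tensor_power_indiscernible _ _ _ _ (G @^-1` P) UP).
  move=> Xl Xl'; have Gl : G [seq nth 0%N s i | i <- n :: values h]
    @[s --> tensor_power U n.+1] --> l by exact: Xl.
  by rewrite GE in Gl; exact: cvg_unique Gl Xl'.
split; apply/val_inj/ffunP => b.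
  apply: (same_limit (fun N g => query (A N) g b)); exact: (BA' _ b).1.
apply: (same_limit (fun N g => answer (A N) g b)); exact: (BA' _ b).2.
Qed.
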